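(* There is a polynomial-time approximation scheme for $\alpha_{B,dec}$-CC-Assignment-Dec: for every fixed constant $\beta$ with $0<\beta<1$ there is a polynomial-time algorithm that, on every instance, returns a feasible assignment whose total Borda satisfaction is at least $\beta\cdot\mathrm{OPT}$.
   Context: There is a set $N=[n]$ of agents and a set $A=\{a_1,\dots,a_m\}$ of alternatives. Each agent $i$ has a preference order $\succ_i$, a strict linear order over $A$; $\mathrm{pos}_i(a)\in[m]$ denotes the position of $a$ in $\succ_i$ (1 = most preferred). An assignment is a function $\Phi:N\to A$. In $\alpha_{B,dec}$-CC-Assignment-Dec (Chamberlin–Courant's rule with Borda satisfaction), the input includes a positive integer $K$; a feasible assignment is one whose image contains at most $K$ alternatives (no limit on how many agents share an alternative); the goal is to maximize the total Borda satisfaction $\sum_{i\in N}(m-\mathrm{pos}_i(\Phi(i)))$, and $\mathrm{OPT}$ denotes the maximum of this quantity over feasible assignments. *)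

(* Defs.v *)
From Stdlib Require Import Reals.
From mathcomp Require Import all_boot all_order all_fingroup.
Set Implicit Arguments.
Unset Strict Implicit.
Unset Printing Implicit Defensive.

(* Agents are 'I_n, alternatives are 'I_m (a_1..a_m = 0..m-1).
   The preference order of agent i is given by the permutation
   pref i : rank -> alternative; (pref i) r is the alternative ranked
   at (0-based) rank r, i.e. position r+1. *)
Record instance := Inst {
  n_ : nat;
  m_ : nat;
  K_ : nat;
  pref_ : {ffun 'I_n_ -> {perm 'I_m_}}
}.

Definition valid_instance (I : instance) : bool := (0 < K_ I) && (0 < m_ I).

Definition assignment (I : instance) := {ffun 'I_(n_ I) -> 'I_(m_ I)}.

(* pos_i(a) in [m], 1 = most preferred *)
Definition pos (I : instance) (i : 'I_(n_ I)) (a : 'I_(m_ I)) : nat :=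
  (nat_of_ord (((pref_ I i)^-1)%g a)).+1.

Definition borda_sat (I : instance) (Phi : assignment I) : nat :=
  \sum_(i < n_ I) (m_ I - pos i (Phi i)).

Definition feasible (I : instance) (Phi : assignment I) : bool :=
  #|[set Phi i | i : 'I_(n_ I)]| <= K_ I.

Definition OPT (I : instance) : nat :=
  \max_(Phi : assignment I | feasible Phi) borda_sat Phi.

Definition encode (I : instance) : seq nat :=
  [:: n_ I; m_ I; K_ I] ++
  flatten [seq [seq nat_of_ord (pref_ I i r) | r <- enum 'I_(m_ I)]
          | i <- enum 'I_(n_ I)].

Definition bitsize (s : seq nat) : nat := \sum_(x <- s) (trunc_log 2 x).+1.

(* Model of computation: unit-cost RAM with addition, truncated        *)
(* subtraction and indirect addressing (polynomially equivalent to      *)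
(* Turing machines).                                                    *)
Inductive cmd :=
| Const of nat & nat
| Add of nat & nat & nat
| Sub of nat & nat & nat
| LoadI of nat & nat
| StoreI of nat & nat
| Seq of cmd & cmd
| If of nat & cmd & cmd
| While of nat & cmd.

Definition memory := nat -> nat.
Definition upd (M : memory) (r v : nat) : memory := fun x => if x == r then v else M x.

Inductive exec : cmd -> memory -> memory -> nat -> Prop :=
| ExConst r k M : exec (Const r k) M (upd M r k) 1
| ExAdd r a b M : exec (Add r a b) M (upd M r (M a + M b)) 1
| ExSub r a b M : exec (Sub r a b) M (upd M r (M a - M b)) 1
| ExLoad r a M : exec (LoadI r a) M (upd M r (M (M a))) 1
| ExStore a r M : exec (StoreI a r) M (upd M (M a) (M r)) 1
| ExSeq c1 c2 M1 M2 M3 t1 t2 :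
    exec c1 M1 M2 t1 -> exec c2 M2 M3 t2 -> exec (Seq c1 c2) M1 M3 (t1 + t2)
| ExIfT r c1 c2 M M' t :
    M r != 0 -> exec c1 M M' t -> exec (If r c1 c2) M M' t.+1
| ExIfF r c1 c2 M M' t :
    M r = 0 -> exec c2 M M' t -> exec (If r c1 c2) M M' t.+1
| ExWhileF r c M : M r = 0 -> exec (While r c) M M 1
| ExWhileT r c M1 M2 M3 t1 t2 :
    M1 r != 0 -> exec c M1 M2 t1 -> exec (While r c) M2 M3 t2 ->
    exec (While r c) M1 M3 (t1 + t2).+1.

Definition init_mem (s : seq nat) : memory :=
  fun x => if x == 0 then size s else nth 0 s x.-1.

Definition outputs (I : instance) (M : memory) (Phi : assignment I) : Prop :=
  forall i : 'I_(n_ I), M (nat_of_ord i) = nat_of_ord (Phi i).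

(* Main.v *)
Require Import Defs.
From Stdlib Require Import Reals Lra.
From mathcomp Require Import all_boot all_order all_fingroup.
From mathcomp Require Import zify.
Set Implicit Arguments.
Unset Strict Implicit.
Unset Printing Implicit Defensive.

(* It suffices to search all tuples of [min K k] alternatives, for a constant
   [k] depending only on beta.  If [K <= k] this covers every feasible image.
   If [K > k], a uniformly random [k]-tuple leaves each agent an expected loss
   of at most [m / (k + 1)] out of [m - 1], so some [k]-tuple already reaches
   [(1 - 2 / (k + 1)) n (m - 1) >= beta OPT].

   On the machine, the input is moved to address [B = 2 ^ h * size] to free the
   low cells; the marks are at [2 B] and two assignment buffers at [3 B] and
   [4 B]. *)

(** * Total correctness with a time bound *)

(** The benchmark n(m - 1) bounds OPT for every K, so for K > k nothing has to be known about an
    optimal assignment. The 2 in 2 / (k + 1) comes from m <= 2(m - 1), valid for m >= 2; for m = 1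
    every value is 0. Tuples may repeat entries, so tuples of one exact length also cover all
    smaller images. Numbers are measured in binary. Hence K can be exponential in the input size and
    is only ever compared with constants. Looping over the m alternatives is affordable once there
    is an agent, whose list has m entries; with n = 0 even m can be exponential, and the search must
    be skipped. At the start the low cells may all be occupied by input, except cell 0, which holds
    its length. As the machine does not multiply, an address beyond the input is obtained by
    doubling cell 0 a constant number of times. The same lack of room returns at the end, when the
    answer has to be written over the registers themselves. *)

Definition runs (c : cmd) (M : memory) (t : nat) (Q : memory -> Prop) : Prop :=
  exists M' t', exec c M M' t' /\ t' <= t /\ Q M'.

Lemma updE M r v : upd M r v r = v.
Proof. by rewrite /upd eqxx. Qed.

Lemma updN M r v x : x != r -> upd M r v x = M x.
Proof. by rewrite /upd => /negPf->. Qed.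

Lemma runs_conseq c M t t' (Q Q' : memory -> Prop) :
  runs c M t Q -> t <= t' -> (forall M', Q M' -> Q' M') -> runs c M t' Q'.
Proof.
move=> [M' [u [ex [le_ut q]]]] le_tt' QQ'; exists M', u; split=> //.
by split; [apply: leq_trans le_tt' | apply: QQ'].
Qed.

Lemma runs_seq c1 c2 M t1 t2 t Q :
  runs c1 M t1 (fun M' => runs c2 M' t2 Q) -> t1 + t2 <= t ->
  runs (Seq c1 c2) M t Q.
Proof.
move=> [M1 [u1 [ex1 [le1 [M2 [u2 [ex2 [le2 q]]]]]]]] le_t.
exists M2, (u1 + u2); split; first exact: ExSeq ex1 ex2.
by split=> //; lia.
Qed.

Lemma runs_const r k M t (Q : memory -> Prop) :
  Q (upd M r k) -> runs (Const r k) M t.+1 Q.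
Proof. by move=> q; exists (upd M r k), 1; split; first exact: ExConst. Qed.

(** Operand contents are named by [u] and [v] and tied to the memory by equations, so that symbolic
    execution can resolve them through the pending updates and keep the new memory free of nested
    lookups. *)
Lemma runs_add r a b u v M t (Q : memory -> Prop) :
  M a = u -> M b = v -> Q (upd M r (u + v)) -> runs (Add r a b) M t.+1 Q.
Proof. by move=> <- <- q; eexists _, 1; split; first exact: ExAdd. Qed.

Lemma runs_sub r a b u v M t (Q : memory -> Prop) :
  M a = u -> M b = v -> Q (upd M r (u - v)) -> runs (Defs.Sub r a b) M t.+1 Q.
Proof. by move=> <- <- q; eexists _, 1; split; first exact: ExSub. Qed.

Lemma runs_load r a u v M t (Q : memory -> Prop) :
  M a = u -> M u = v -> Q (upd M r v) -> runs (LoadI r a) M t.+1 Q.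
Proof. by move=> <- <- q; eexists _, 1; split; first exact: ExLoad. Qed.

Lemma runs_store r a u v M t (Q : memory -> Prop) :
  M a = u -> M r = v -> Q (upd M u v) -> runs (StoreI a r) M t.+1 Q.
Proof. by move=> <- <- q; eexists _, 1; split; first exact: ExStore. Qed.

Lemma runs_if r c1 c2 u M t Q :
  M r = u -> (u != 0 -> runs c1 M t Q) -> (u = 0 -> runs c2 M t Q) ->
  runs (If r c1 c2) M t.+1 Q.
Proof.
move=> Mr h1 h2; case: (eqVneq u 0) => [u0|un0].
  have [M' [u' [ex [le q]]]] := h2 u0.
  by exists M', u'.+1; split=> //; apply: ExIfF; rewrite ?Mr.
have [M' [u' [ex [le q]]]] := h1 un0.
by exists M', u'.+1; split=> //; apply: ExIfT; rewrite ?Mr.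
Qed.

Lemma runs_step c1 c2 M t Q :
  runs c1 M 1 (fun M' => runs c2 M' t Q) -> runs (Seq c1 c2) M t.+1 Q.
Proof. by move=> h; apply: runs_seq h _. Qed.

(* Cell 0 holds the constant 1 while loops are running. *)
Definition for_ r body := While r (Seq (Defs.Sub r r 0) body).

(** The invariant is indexed by the number of remaining rounds. The counter is decremented before
    the body, which therefore starts in [upd M r j] and sees the indices N - 1, ..., 0. Each round
    costs the body, the test and the decrement; the final failing test makes the bound strict. *)
Lemma runs_for r body T N (Inv : nat -> memory -> Prop) M t :
  (forall j M, Inv j M -> M r = j /\ M 0 = 1) ->
  (forall j M, j < N -> Inv j.+1 M -> runs body (upd M r j) T (Inv j)) ->
  Inv N M -> N * T.+2 < t -> runs (for_ r body) M t (Inv 0).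
Proof.
move=> ctl; elim: N M t => [|N IHN] M t body_ok inv lt_t.
  have [Mr _] := ctl _ _ inv.
  by exists M, 1; split; [exact: ExWhileF | split].
have [Mr M0] := ctl _ _ inv.
have [M1 [u1 [ex1 [le1 inv1]]]] := body_ok N M (ltnSn N) inv.
have [||M2 [u2 [ex2 [le2 inv2]]]] := IHN M1 (N * T.+2).+1 _ inv1 => //.
  by move=> j M3 ltj; apply: body_ok; lia.
exists M2, (1 + u1 + u2).+1; split; last by split=> //; lia.
apply: ExWhileT ex2; first by rewrite Mr.
apply: ExSeq ex1; have ->: N = M r - M 0 by rewrite Mr M0 subn1.
exact: ExSub.
Qed.

Declare Scope ram_scope.
Notation "c ;; d" := (Seq c d)
  (at level 60, right associativity) : ram_scope.
Local Open Scope ram_scope.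

Ltac upds := repeat first [rewrite updE | rewrite updN; [|solve [done | lia]]].
Ltac rd := upds; first [eassumption | reflexivity].
Ltac instr :=
  first [ apply: runs_const | apply: runs_add; [rd | rd |]
        | apply: runs_sub; [rd | rd |] | apply: runs_load; [rd | rd |]
        | apply: runs_store; [rd | rd |] ].
Ltac step := first [ instr | apply: runs_step; instr ].

(** * Evaluating a set of marked alternatives *)

(* Cell 0 holds 1, cells 1, 2, 3 hold n, m, K, cells 4, 5, 6, 7 point to the
   preferences, the marks, the current and the best assignment, cell 8 holds 1
   plus the best value (0 if there is none yet), cells 9-16 are scratch, and
   17 + j is the counter of the j-th nested loop over the alternatives. *)
Definition scan :=
  Const 13 0 ;; Add 13 13 2 ;;
  for_ 13 (
    Add 15 10 13 ;; LoadI 15 15 ;; Add 16 5 15 ;; LoadI 16 16 ;;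
    If 16 (StoreI 11 15 ;; Add 14 13 0) (Const 16 0)).

(** Ranks are visited from worst to best and every marked alternative overwrites the previous hit,
    so the most preferred marked one survives. A mark must exist: otherwise cells 14 and [q] would
    keep stale contents. *)
Lemma scanP M m mb p q r :
  M 0 = 1 -> M 2 = m -> M 5 = mb -> M 10 = p -> M 11 = q ->
  17 <= p -> 17 <= mb -> 17 <= q ->
  (forall s, s < m -> p + s != q) ->
  (forall s, s < m -> mb + M (p + s) != q) ->
  r < m -> M (mb + M (p + r)) != 0 ->
  (forall s, s < r -> M (mb + M (p + s)) = 0) ->
  runs scan M (10 * m + 5) (fun M' =>
    [/\ M' 14 = r.+1, M' q = M (p + r) &
      forall x, ~~ (12 < x < 17) -> x != q -> M' x = M x]).
Proof.
move=> M0 M2 M5 M10 M11 p17 mb17 q17 pq mq rm mr mins.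
have -> : 10 * m + 5 = (10 * m + 3).+2 by lia.
do 2 step.
(* Nothing is claimed about the result before rank [r] has been visited; afterwards only unmarked
   ranks remain. *)
pose Inv j (M' : memory) := [/\ M' 13 = j,
  (j <= r -> M' 14 = r.+1 /\ M' q = M (p + r)) &
  forall x, ~~ (12 < x < 17) -> x != q -> M' x = M x].
apply: (@runs_conseq _ _ _ _ (Inv 0)); last first.
  move=> M' [_ h fr]; have [h1 h2] := h (leq0n r).
  by split.
  exact: leqnn.
apply: (@runs_for _ _ 7 m) => [j M' [h _ fr]|j M' ltj [h hr fr]||].
- by split=> //; rewrite fr //; lia.
- have fr' x : ~~ (12 < x < 17) -> x != q -> upd M' 13 j x = M x.
    by move=> xr xq; rewrite updN ?fr //; lia.
  have e10 : upd M' 13 j 10 = p by rewrite fr' //; lia.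
  have e11 : upd M' 13 j 11 = q by rewrite fr' //; lia.
  have e5 : upd M' 13 j 5 = mb by rewrite fr' //; lia.
  have e0 : upd M' 13 j 0 = 1 by rewrite fr' //; lia.
  have e13 : upd M' 13 j 13 = j by rewrite updE.
  have e14 : upd M' 13 j 14 = M' 14 by rewrite updN.
  have eq : upd M' 13 j q = M' q by rewrite updN //; lia.
  have ea : upd M' 13 j (p + j) = M (p + j) by rewrite fr' //; [lia | apply: pq].
  have em : upd M' 13 j (mb + M (p + j)) = M (mb + M (p + j)).
    by rewrite fr' //; [lia | apply: mq].
  move: (upd M' 13 j) fr' e10 e11 e5 e0 e13 e14 eq ea em => M1 fr' *.
  have q15 : (q == 15) = false by lia.
  do 4 step.
  apply: runs_if; first by rd.
    move=> mj; do 2 step; split; first by rd.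
      move=> jr; have jr' : j = r.
        by apply/eqP; rewrite eqn_leq jr /= leqNgt; apply/negP => /mins; lia.
      by split; upds; rewrite ?jr' ?addn1.
    by move=> x xr xq; upds; apply: fr'.
  move=> mj; step; split; first by rd.
    move=> jr; have ltjr : j < r.
      by rewrite ltn_neqAle jr andbT; apply/eqP => ej; move: mr; rewrite -ej mj.
    by have [h1 h2] := hr ltjr; split; upds; rewrite -?h1 -?h2.
  by move=> x xr xq; upds; apply: fr'.
- split; [by rd | by lia |].
  by move=> x xr xq; upds.
- by lia.
Qed.

(** Clearing a cell and adding to it serves as a copy instruction. Cell 9 starts at 1 because it
    accumulates one plus the value. The pointers 10 and 11 move upwards through the agents while the
    counter 12 goes down. *)
Definition evaluate :=
  Const 9 1 ;; Const 10 0 ;; Add 10 10 4 ;; Const 11 0 ;; Add 11 11 6 ;;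
  Const 12 0 ;; Add 12 12 1 ;;
  for_ 12 (scan ;; Defs.Sub 16 2 14 ;; Add 9 9 16 ;; Add 10 10 2 ;;
           Add 11 11 0).

Lemma evaluateP M n m P0 mb cur (rk : nat -> nat) :
  M 0 = 1 -> M 1 = n -> M 2 = m -> M 4 = P0 -> M 5 = mb -> M 6 = cur ->
  17 <= P0 -> P0 + n * m <= mb -> mb + m <= cur ->
  (forall q, q < n * m -> M (P0 + q) < m) ->
  (forall i, i < n -> rk i < m) ->
  (forall i, i < n -> M (mb + M (P0 + (i * m + rk i))) != 0) ->
  (forall i s, i < n -> s < rk i -> M (mb + M (P0 + (i * m + s))) = 0) ->
  runs evaluate M (n * (10 * m + 11) + 8) (fun M' =>
    [/\ M' 9 = (\sum_(0 <= i < n) (m - (rk i).+1)).+1,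
        forall i, i < n -> M' (cur + i) = M (P0 + (i * m + rk i)) &
        forall x, ~~ (8 < x < 17) -> ~~ (cur <= x < cur + n) -> M' x = M x]).
Proof.
move=> M0 M1 M2 M4 M5 M6 P17 Pmb mbc prefm rkm mark minr.
have -> : n * (10 * m + 11) + 8 = (n * (10 * m + 11) + 1).+4.+3 by lia.
do 7 step.
pose fr (M' : memory) :=
  forall x, ~~ (8 < x < 17) -> ~~ (cur <= x < cur + n) -> M' x = M x.
pose Inv j (M' : memory) := j <= n /\ [/\ M' 12 = j,
  M' 9 = (\sum_(0 <= i < n - j) (m - (rk i).+1)).+1,
  M' 10 = P0 + (n - j) * m /\ M' 11 = cur + (n - j),
  forall i, i < n - j -> M' (cur + i) = M (P0 + (i * m + rk i)) & fr M'].
apply: (@runs_conseq _ _ _ _ (Inv 0)); last first.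
- by move=> M' [_ [_ h9 _ hc h]]; rewrite subn0 in h9 hc; split.
- exact: leqnn.
apply: (@runs_for _ _ (10 * m + 9) n)
    => [j M' [_ [h _ _ _ hf]]|j M' ltj [_ [_ h9 [h10 h11] hc hf]]||].
- by split=> //; rewrite hf //; lia.
- have [i ei] : exists i, i = n - j.+1 by exists (n - j.+1).
  have ltin : i < n by lia.
  have im : i * m + m <= n * m by rewrite addnC -mulSn leq_mul2r ltin orbT.
  rewrite -ei in h9 h10 h11 hc.
  have P (x : nat) : ~~ (8 < x < 17) -> ~~ (cur <= x < cur + n) ->
      upd M' 12 j x = M x.
    by move=> xr xq; rewrite updN ?hf //; lia.
  have e0 : upd M' 12 j 0 = 1 by rewrite P //; lia.
  have e2 : upd M' 12 j 2 = m by rewrite P //; lia.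
  have e5 : upd M' 12 j 5 = mb by rewrite P //; lia.
  have e12 : upd M' 12 j 12 = j by rewrite updE.
  have e9 : upd M' 12 j 9 = (\sum_(0 <= i < i) (m - (rk i).+1)).+1.
    by rewrite updN.
  have e10 : upd M' 12 j 10 = P0 + i * m by rewrite updN.
  have e11 : upd M' 12 j 11 = cur + i by rewrite updN.
  have ec k : k < i -> upd M' 12 j (cur + k) = M (P0 + (k * m + rk k)).
    by move=> ltk; rewrite updN ?hc //; lia.
  have ep s : s < m -> upd M' 12 j (P0 + i * m + s) = M (P0 + (i * m + s)).
    by move=> lts; rewrite -addnA P //; lia.
  have em s : s < m ->
      upd M' 12 j (mb + M (P0 + (i * m + s))) = M (mb + M (P0 + (i * m + s))).
    move=> lts; have lta : M (P0 + (i * m + s)) < m by apply: prefm; lia.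
    by rewrite P //; lia.
  move: (upd M' 12 j) P e0 e2 e5 e12 e9 e10 e11 ec ep em
    => N P e0 e2 e5 e12 e9 e10 e11 ec ep em.
  have rki := rkm i ltin.
  apply: (@runs_seq _ _ _ (10 * m + 5) 4); last by lia.
  apply: runs_conseq (leqnn _) _.
    apply: (@scanP N m mb (P0 + i * m) (cur + i) (rk i)) => //.
  + by lia.
  + by lia.
  + by lia.
  + by move=> s lts; lia.
  + move=> s lts; have lta : M (P0 + (i * m + s)) < m by apply: prefm; lia.
    by rewrite ep //; lia.
  + by rewrite ep // em // mark.
  + by move=> s lts; have ltsm := ltn_trans lts rki; rewrite ep ?em ?minr.
  move=> N' [n14 nq frN].
  have f0 : N' 0 = 1 by rewrite frN //; lia.
  have f2 : N' 2 = m by rewrite frN //; lia.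
  have f12 : N' 12 = j by rewrite frN //; lia.
  have f9 : N' 9 = (\sum_(0 <= i < i) (m - (rk i).+1)).+1.
    by rewrite frN //; lia.
  have f10 : N' 10 = P0 + i * m by rewrite frN //; lia.
  have f11 : N' 11 = cur + i by rewrite frN //; lia.
  rewrite ep // in nq.
  do 4 step.
  have e1 : n - j = i.+1 by lia.
  split; first by lia.
  rewrite e1; split.
  + by rd.
  + by upds; rewrite big_nat_recr.
  + by split; upds; lia.
  + move=> k; rewrite ltnS leq_eqVlt => /orP[/eqP->|ltk].
      by upds.
    by upds; rewrite frN; [apply: ec | lia | lia].
  + move=> x xr xc; upds; rewrite frN; [|lia|lia].
    exact: P.
- split=> //; rewrite subnn; split.
  + by rd.
  + by rewrite big_geq //; rd.
  + by split; upds; rewrite ?mul0n !addn0.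
  + by [].
  + by move=> x xr xc; upds.
- by lia.
Qed.

(** * Enumerating tuples of alternatives *)

Lemma best_in (I : instance) (T : seq 'I_(m_ I)) : 0 < size T ->
  exists2 rho : {ffun 'I_(n_ I) -> 'I_(m_ I)},
    forall i, pref_ I i (rho i) \in T &
    forall i s, pref_ I i s \in T -> rho i <= s.
Proof.
case: T => // a T _.
have P0 i : pref_ I i ((pref_ I i)^-1%g a) \in a :: T.
  by rewrite permKV mem_head.
exists [ffun i =>
  [arg min_(r < (pref_ I i)^-1%g a | pref_ I i r \in a :: T) (r : nat)]].
  by move=> i; rewrite ffunE; case: arg_minnP.
by move=> i s si; rewrite ffunE; case: arg_minnP => // r _; apply.
Qed.

Lemma pos_rank (I : instance) (i : 'I_(n_ I)) r :
  Defs.pos i (pref_ I i r) = r.+1.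
Proof. by rewrite /Defs.pos permK. Qed.

Lemma feasible_seq (I : instance) (T : seq 'I_(m_ I)) (Phi : assignment I) :
  size T <= K_ I -> (forall i, Phi i \in T) -> feasible Phi.
Proof.
move=> leTK PhiT; apply: leq_trans leTK; apply: leq_trans (card_size T).
by apply/subset_leq_card/subsetP => _ /imsetP[i _ ->].
Qed.

Lemma row_le (I : instance) (i : 'I_(n_ I)) :
  i * m_ I + m_ I <= n_ I * m_ I.
Proof. by rewrite addnC -mulSn leq_mul2r ltn_ord orbT. Qed.

(* The current and best assignments live in the arrays at 6 and 7, which are
   swapped whenever the current one is better. *)
Definition attempt :=
  evaluate ;; Defs.Sub 16 9 8 ;;
  If 16 (Const 8 0 ;; Add 8 8 9 ;; Const 15 0 ;; Add 15 15 6 ;;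
         Const 6 0 ;; Add 6 6 7 ;; Const 7 0 ;; Add 7 7 15)
        (Const 16 0).

Fixpoint enum_tuples j :=
  if j is j'.+1 then
    Const (17 + j') 0 ;; Add (17 + j') (17 + j') 2 ;;
    for_ (17 + j') (
      Add 15 5 (17 + j') ;; LoadI 16 15 ;; Add 16 16 0 ;; StoreI 15 16 ;;
      enum_tuples j' ;;
      Add 15 5 (17 + j') ;; LoadI 16 15 ;; Defs.Sub 16 16 0 ;; StoreI 15 16)
  else attempt.

Definition base (I : instance) (B : nat) (M : memory) : Prop :=
  [/\ M 0 = 1 /\ M 1 = n_ I, M 2 = m_ I /\ M 3 = K_ I,
      M 4 = B + 3 /\ M 5 = 2 * B,
      (M 6 = 3 * B /\ M 7 = 4 * B) \/ (M 6 = 4 * B /\ M 7 = 3 * B) &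
      forall (i : 'I_(n_ I)) (r : 'I_(m_ I)),
        M (B + 3 + (i * m_ I + r)) = pref_ I i r].

(** Multiplicities are kept instead of bits: a tuple may contain an alternative twice, and unmarking
    one occurrence must leave the other in force. *)
Definition marks (I : instance) (B : nat) (T : seq 'I_(m_ I)) (M : memory) :
    Prop :=
  forall a : 'I_(m_ I), M (2 * B + a) = count_mem a T.

Definition best (I : instance) (v : nat) (M : memory) : Prop :=
  M 8 = v /\ (v = 0 \/ exists Phi : assignment I, [/\ feasible Phi,
    v = (borda_sat Phi).+1 & forall i : 'I_(n_ I), M (M 7 + i) = Phi i]).

Definition beats (I : instance) (T : seq 'I_(m_ I)) (v : nat) : Prop :=
  forall Psi : assignment I, (forall i, Psi i \in T) -> borda_sat Psi < v.

(** Giving each agent its favourite alternative in [T] is optimal agent by agent among assignments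
    into [T], and it is feasible because [T] has at most K entries. Truncated subtraction serves as
    the comparison: cell 16 is nonzero exactly when the new value is strictly better. *)
Lemma attemptP (I : instance) B (T : seq 'I_(m_ I)) v M :
  0 < n_ I -> 3 + n_ I * m_ I <= B -> 17 <= B ->
  base I B M -> marks B T M -> best I v M -> 0 < size T <= K_ I ->
  runs attempt M (n_ I * (10 * m_ I + 11) + 18) (fun M' => exists v',
    [/\ base I B M' /\ marks B T M', best I v' M', v <= v', beats T v' &
      forall x, 17 <= x < B -> M' x = M x]).
Proof.
move=> n0 SB B17 [[M0 M1] [M2 M3] [M4 M5] M67 Mp] Mm [M8 Mb] /andP[T0 TK].
have [rho rhoT rho_min] := best_in T0.
have ltm : m_ I <= n_ I * m_ I by rewrite leq_pmull.
have ltn : n_ I <= n_ I * m_ I.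
  by case: (T) T0 => // a _ _; rewrite leq_pmulr // (leq_ltn_trans _ (ltn_ord a)).
(* [evaluateP] speaks of ranks indexed by plain numbers; the default 0 outside the agents is never
   inspected. *)
pose rk k := if insub k is Some i then rho i : nat else 0.
have rkE (i : 'I_(n_ I)) : rk i = rho i by rewrite /rk valK.
pose Phi : assignment I := [ffun i => pref_ I i (rho i)].
have PhiT i : Phi i \in T by rewrite ffunE.
have PhiE : \sum_(0 <= i < n_ I) (m_ I - (rk i).+1) = borda_sat Phi.
  by rewrite big_mkord; apply: eq_bigr => i _; rewrite ffunE pos_rank rkE.
have cur1 : 2 * B + m_ I <= M 6 by lia.
have dj x : x < n_ I -> ~~ (M 6 <= M 7 + x < M 6 + n_ I) by lia.
have cur2 y : y <= 2 * B -> ~~ (M 6 <= y < M 6 + n_ I) by lia.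
have c6 : ~~ (M 6 <= 6 < M 6 + n_ I) by apply: cur2; lia.
have prefM k s (ltk : k < n_ I) (lts : s < m_ I) :
  M (B + 3 + (k * m_ I + s)) = pref_ I (Ordinal ltk) (Ordinal lts).
  by rewrite -Mp.
apply: (@runs_seq _ _ _ (n_ I * (10 * m_ I + 11) + 8) 10); last by lia.
apply: runs_conseq (leqnn _) _.
  apply: (@evaluateP M (n_ I) (m_ I) (B + 3) (2 * B) (M 6) rk) => //.
  - by lia.
  - by lia.
  - move=> q ltq; have m0 : 0 < m_ I by case: (m_ I) ltq; rewrite ?muln0.
    have ltk : q %/ m_ I < n_ I by rewrite ltn_divLR.
    by rewrite [in B + 3 + q](divn_eq q (m_ I)) (prefM _ _ ltk (ltn_pmod q m0)).
  - by move=> k ltk; rewrite (rkE (Ordinal ltk)).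
  - move=> k ltk; rewrite (rkE (Ordinal ltk)) (Mp (Ordinal ltk)) Mm.
    by rewrite -lt0n -has_count has_pred1.
  - move=> k s ltk; rewrite (rkE (Ordinal ltk)) => lts.
    have ltsm := ltn_trans lts (ltn_ord _).
    rewrite (prefM _ _ ltk ltsm) Mm; apply/count_memPn/negP => /rho_min.
    by rewrite /= leqNgt lts.
move=> N [N9 Nc Nfr].
have fr y : ~~ (8 < y < 17) -> y <= 2 * B -> N y = M y.
  by move=> ? ?; apply: Nfr => //; apply: cur2.
have Np (i : 'I_(n_ I)) (r : 'I_(m_ I)) :
    N (B + 3 + (i * m_ I + r)) = pref_ I i r.
  have im := row_le i.
  have ltr := ltn_ord r.
  by rewrite fr ?Mp //; lia.
have Nm : marks B T N.
  move=> a; have lta := ltn_ord a.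
  by rewrite Nfr ?Mm //; lia.
have Nb i : N (M 7 + i) = M (M 7 + i) \/ n_ I <= i.
  by case: (leqP (n_ I) i) => [|lti]; [right | left; rewrite Nfr ?dj //; lia].
have [N0 N1] : N 0 = 1 /\ N 1 = n_ I by rewrite !fr //; lia.
have [N2 N3] : N 2 = m_ I /\ N 3 = K_ I by rewrite !fr //; lia.
have [N4 N5] : N 4 = B + 3 /\ N 5 = 2 * B by rewrite !fr //; lia.
have [N6 N7] : N 6 = M 6 /\ N 7 = M 7 by rewrite !fr //; lia.
have N8 : N 8 = v by rewrite !fr //; lia.
have Nc' (i : 'I_(n_ I)) : N (M 6 + i) = Phi i by rewrite Nc // rkE Mp ffunE.
have PhiF : feasible Phi := feasible_seq TK PhiT.
have PhiB : beats T (borda_sat Phi).+1.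
  move=> Psi PsiT; rewrite ltnS leq_sum // => i _; rewrite ffunE pos_rank.
  rewrite leq_sub2l // /Defs.pos ltnS; apply: rho_min.
  by rewrite permKV.
rewrite PhiE in N9.
step.
apply: runs_if; first by rd.
  move=> lt_v; do 8 step.
  exists (borda_sat Phi).+1; split=> //.
  - split; first split.
    + by split; upds.
    + by split; upds.
    + by split; upds.
    + by rewrite !(updE, updN) //; lia.
    + by move=> i r; upds; apply: Np.
    + by move=> a; upds; apply: Nm.
  - split; first by upds.
    right; exists Phi; split=> // i.
    by rewrite !(updE, updN) ?N6 ?Nc' //; lia.
  - by lia.
  - by move=> x xB; upds; apply: fr; lia.
move=> le_v; step; exists v; split=> //.
- split; first split.
  + by split; upds.
  + by split; upds.
  + by split; upds.
  + by rewrite !updN // N6 N7; lia.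
  + by move=> i r; upds; apply: Np.
  + by move=> a; upds; apply: Nm.
- split; first by upds.
  case: Mb => [->|[Psi [h1 h2 h3]]]; [by left | right; exists Psi; split=> //].
  move=> i; have lti := ltn_ord i.
  have -> : upd (upd N 16 ((borda_sat Phi).+1 - v)) 16 0 7 = M 7 by upds.
  rewrite -h3.
  by case: (Nb i) => [<-|]; [upds | lia].
- by move=> Psi /PhiB; lia.
- by move=> x xB; upds; apply: fr; lia.
Qed.

Definition searching (I : instance) B (T : seq 'I_(m_ I)) v (M : memory) :
    Prop :=
  [/\ base I B M, marks B T M & best I v M].

(** This serves both for marking and for unmarking [a]. Scratch cells and loop counters lie strictly
    between 8 and [B], where any change is allowed. *)
Lemma searching_mark (I : instance) B (T T' : seq 'I_(m_ I)) a v M M' :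
  3 + n_ I * m_ I <= B -> 0 < n_ I -> 17 <= B ->
  searching B T v M ->
  (forall b, b != a -> count_mem b T' = count_mem b T) ->
  M' (2 * B + a) = count_mem a T' ->
  (forall x, (x <= 8) || (B <= x) -> x != 2 * B + a -> M' x = M x) ->
  searching B T' v M'.
Proof.
move=> SB n0 B17 [[[M0 M1] [M2 M3] [M4 M5] M67 Mp] Mm [M8 Mb]] cT Ma fr.
have ltm : m_ I <= n_ I * m_ I by rewrite leq_pmull.
have lta := ltn_ord a.
have M6' : M' 6 = M 6 by rewrite fr //; lia.
have M7' : M' 7 = M 7 by rewrite fr //; lia.
split.
- split; rewrite ?M6' ?M7' // ?fr //; try lia.
  move=> i r; rewrite -Mp fr //; try lia.
  have im := row_le i.
  by have := ltn_ord r; lia.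
- move=> b; have [->|ab] := eqVneq b a; first by [].
  have nab : (b : nat) != a by [].
  by rewrite cT // fr ?Mm //; lia.
- split; first by rewrite fr //; lia.
  case: Mb => [->|[Phi [h1 h2 h3]]]; [by left | right; exists Phi; split=> //].
  by move=> i; rewrite M7' -h3 fr //; lia.
Qed.

Lemma searching_ext (I : instance) B (T : seq 'I_(m_ I)) v M M' :
  3 + n_ I * m_ I <= B -> 17 <= B -> searching B T v M ->
  (forall x, (x <= 8) || (B <= x) -> M' x = M x) ->
  searching B T v M'.
Proof.
move=> SB B17 [[[M0 M1] [M2 M3] [M4 M5] M67 Mp] Mm [M8 Mb]] fr.
have M6' : M' 6 = M 6 by rewrite fr //; lia.
have M7' : M' 7 = M 7 by rewrite fr //; lia.
split.
- split; rewrite ?M6' ?M7' // ?fr //; try lia.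
  by move=> i r; rewrite -Mp fr //; lia.
- by move=> b; rewrite fr ?Mm //; lia.
- split; first by rewrite fr //; lia.
  case: Mb => [->|[Phi [h1 h2 h3]]]; [by left | right; exists Phi; split=> //].
  by move=> i; rewrite M7' -h3 fr //; lia.
Qed.

Fixpoint enum_time n m j :=
  if j is j'.+1 then m * (enum_time n m j' + 10) + 4
  else n * (10 * m + 11) + 18.

(** [T] collects the choices of the enclosing loops, and the last clause protects their counters.
    The size condition makes every complete tuple nonempty, as the scan requires, and short enough
    to be feasible. *)
Lemma enum_tuplesP (I : instance) B j (T : seq 'I_(m_ I)) v M :
  0 < n_ I -> 3 + n_ I * m_ I <= B -> 17 + j <= B ->
  searching B T v M -> 0 < size T + j <= K_ I ->
  runs (enum_tuples j) M (enum_time (n_ I) (m_ I) j) (fun M' => exists v',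
    [/\ searching B T v' M', v <= v',
        forall T', size T' = j -> beats (T' ++ T) v' &
        forall x, 17 + j <= x < B -> M' x = M x]).
Proof.
move=> n0 SB; elim: j T v M => [|j IHj] T v M.
  rewrite !addn0 => B17 [Mbase Mm Mb] TK.
  apply: runs_conseq (leqnn _) _; first exact: attemptP Mbase Mm Mb TK.
  move=> M' [v' [[h1 h2] h3 le h4 h5]]; exists v'; split=> //.
  by case.
move=> Bj st TK; have B17 : 17 <= B by lia.
have [[_ [M2 _] _ _ _] _ _] := st.
have -> : enum_time (n_ I) (m_ I) j.+1 =
  (m_ I * (enum_time (n_ I) (m_ I) j + 8).+2 + 2).+2.
  by rewrite /=; lia.
rewrite [enum_tuples _]/=; do 2 step.
pose r := 17 + j; rewrite -/r.
pose Inv c (N : memory) := exists v', [/\ searching B T v' N, v <= v',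
  forall (a : 'I_(m_ I)) T', c <= a -> size T' = j -> beats (T' ++ a :: T) v',
  c <= m_ I /\ N r = c & forall x, 17 + j.+1 <= x < B -> N x = M x].
apply: (@runs_conseq _ _ _ _ (Inv 0)); last first.
- move=> N [v' [h1 le h2 _ h3]]; exists v'; split=> // T' sT'.
  (* The loop at this level places its alternative directly in front of [T], so it chooses the last
     entry of [T']. *)
  case/lastP: T' sT' => // T' a; rewrite size_rcons => -[sT'].
  by rewrite cat_rcons; apply: h2.
- exact: leqnn.
apply: (@runs_for _ _ (enum_time (n_ I) (m_ I) j + 8) (m_ I)).
- by move=> c N [v' [[[[N0 _] _ _ _ _] _ _] _ _ [_ Nr] _]].
- move=> c M' ltc [v1 [st1 le1 bt1 [_ _] fr1]].
  have st2 : searching B T v1 (upd M' r c).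
    by apply: searching_ext st1 _ => // x xB; rewrite updN //; lia.
  have fr2 x : 17 + j.+1 <= x < B -> upd M' r c x = M x.
    by move=> xB; rewrite updN ?fr1 //; lia.
  have er : upd M' r c r = c by rewrite updE.
  move: (upd M' r c) st2 fr2 er => N st2 fr2 er {st1 fr1 M'}.
  have [[[N0 N1] [N2 N3] [N4 N5] N67 Np] Nm [N8 Nb]] := st2.
  pose a := Ordinal ltc.
  have Na : N (2 * B + c) = count_mem a T by rewrite -Nm.
  have -> : enum_time (n_ I) (m_ I) j + 8 = (enum_time (n_ I) (m_ I) j + 4).+4.
    by lia.
  do 4 step.
  apply: (@runs_seq _ _ _ (enum_time (n_ I) (m_ I) j) 4); last by lia.
  apply: runs_conseq (leqnn _) _.
  + apply: (IHj (a :: T) v1); [by lia | | by rewrite /=; lia].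
    apply: (searching_mark (a := a) SB n0 B17 st2) => [b ba||x xB xa].
    * by rewrite /= eq_sym (negPf ba).
    * by upds; rewrite /= eqxx addnC.
    * by upds.
  + move=> M1 /= [v2 [st3 le2 bt2 fr3]].
    have [[[P0 P1] [P2 P3] [P4 P5] P67 Pp] Pm [P8 Pb]] := st3.
    have Pa : M1 (2 * B + c) = (count_mem a T).+1 by rewrite (Pm a) /= eqxx.
    have Pr : M1 r = c by rewrite fr3 /r; [upds | lia].
    do 4 step.
    exists v2; split.
    * apply: (searching_mark (a := a) SB n0 B17 st3) => [b ba||x xB xa].
      - by rewrite /= eq_sym (negPf ba).
      - by upds; rewrite subn1.
      - by upds.
    * exact: leq_trans le2.
    * move=> b T'; rewrite leq_eqVlt => /orP[/eqP cb|ltb] sT'.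
        have -> : b = a by apply: val_inj; rewrite /= -cb.
        exact: bt2.
      by move=> Psi /(bt1 b T' ltb sT') /leq_trans; apply.
    * by split; [lia | upds].
    * by move=> x xB; upds; rewrite fr3; [upds; apply: fr2 | lia].
- exists v; split=> //.
  + apply: searching_ext st _ => // x xB.
    by upds.
  + by move=> a T'; rewrite leqNgt ltn_ord.
  + by split; [|upds].
  + by move=> x xB; upds.
- by lia.
Qed.

(** The nesting depth is fixed in the program text while K is input, so one loop nest is provided
    for each depth up to [k]. Cell 15 is nonzero exactly when K >= k' + 1, so the deepest admissible
    nest runs; for K > 0 the last default is not reached. *)
Fixpoint dispatch k :=
  if k is k'.+1 then
    Const 15 k' ;; Defs.Sub 15 3 15 ;; If 15 (enum_tuples k) (dispatch k')
  else Const 15 0.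

Fixpoint dispatch_time n m k :=
  if k is k'.+1 then enum_time n m k + dispatch_time n m k' + 3 else 1.

Lemma dispatchP (I : instance) B k v M :
  0 < n_ I -> 3 + n_ I * m_ I <= B -> 17 + k <= B -> 0 < k -> 0 < K_ I ->
  searching B (Nil 'I_(m_ I)) v M ->
  runs (dispatch k) M (dispatch_time (n_ I) (m_ I) k) (fun M' => exists v',
    searching B (Nil 'I_(m_ I)) v' M' /\
    forall T : seq 'I_(m_ I), size T = minn k (K_ I) -> beats T v').
Proof.
move=> n0 SB; elim: k M => // k IHk M Bk _ K0 st.
have [[_ [_ M3] _ _ _] _ _] := st.
have -> : dispatch_time (n_ I) (m_ I) k.+1 =
  (enum_time (n_ I) (m_ I) k.+1 + dispatch_time (n_ I) (m_ I) k).+3.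
  by rewrite [LHS]/= addn3.
rewrite [dispatch _]/=; do 2 step.
set N := upd _ _ _.
have stN : searching B (Nil 'I_(m_ I)) v N.
  by apply: searching_ext st _; [lia | lia |] => x xB; rewrite /N; upds.
apply: runs_if; first by rewrite /N; rd.
  move=> leK; apply: runs_conseq.
  - apply: (enum_tuplesP (j := k.+1) n0 SB _ stN); [by lia | by rewrite /=; lia].
  - exact: leq_addr.
  move=> M' [v' [st' _ bt _]]; exists v'; split=> // T sT.
  by rewrite -[T]cats0; apply: bt; lia.
move=> gtK; apply: runs_conseq.
- by apply: (IHk N) => //; lia.
- exact: leq_addl.
move=> M' [v' [st' bt]]; exists v'; split=> // T sT.
by apply: bt; lia.
Qed.

(** * Moving the input out of and the output into the registers *)

Lemma runs_doubling h c M t Q :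
  (forall M', M' 0 = 2 ^ h * M 0 -> (forall x, x != 0 -> M' x = M x) ->
    runs c M' t Q) ->
  runs (iter h (Seq (Add 0 0 0)) c) M (h + t) Q.
Proof.
elim: h M => [|h IHh] M H; first by apply: H; rewrite ?mul1n.
rewrite addSn /=; step; apply: IHh => M' M'0 fr; apply: H.
  by rewrite M'0 updE expnS; lia.
by move=> x x0; rewrite fr // updN.
Qed.

(* Cells 1 to 5 are saved first, through the only free cell 0. *)
Definition relocate :=
  StoreI 0 1 ;; Const 1 1 ;;
  Add 0 0 1 ;; StoreI 0 2 ;; Add 0 0 1 ;; StoreI 0 3 ;;
  Add 0 0 1 ;; StoreI 0 4 ;; Add 0 0 1 ;; StoreI 0 5 ;;
  Const 2 4 ;; Defs.Sub 2 0 2 ;; Const 3 6 ;; Defs.Sub 3 2 3 ;; Const 0 1 ;;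
  for_ 3 (Const 4 6 ;; Add 4 3 4 ;; Add 5 2 4 ;; Defs.Sub 5 5 0 ;; LoadI 4 4 ;;
          StoreI 5 4).

(** Cell 0 no longer holds the input length but the larger [B], so all cells below [B] are copied,
    padding included. Sources lie below [B] and targets from [B] on, so no pending source is
    overwritten. The shift is B - 1 because the input starts in cell 1. *)
Lemma relocateP B M : 17 <= B -> M 0 = B ->
  runs relocate M (8 * B + 16) (fun M' =>
    [/\ M' 0 = 1, M' 2 = B,
        forall p, 0 < p < B -> M' (B.-1 + p) = M p &
        forall x, 2 * B <= x -> M' x = M x]).
Proof.
move=> B17 M0.
have -> : 8 * B + 16 = (8 * B + 1).+4.+4.+4.+3 by lia.
do 15 step.
pose Inv c (N : memory) := [/\ N 3 = c /\ c <= B - 6, N 0 = 1 /\ N 2 = B,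
  forall p, (0 < p < 6) || (c + 6 <= p < B) -> N (B.-1 + p) = M p,
  forall x, 6 <= x < B -> N x = M x & forall x, 2 * B <= x -> N x = M x].
apply: (@runs_conseq _ _ _ _ (Inv 0)); last first.
- by move=> N [_ [N0 N2] Np _ Nh]; split=> // p pB; apply: Np; lia.
- exact: leqnn.
apply: (@runs_for _ _ 6 (B - 6) Inv)
    => [c N [[N3 _] [N0 _] _ _ _] //|c N ltc [[N3 _] [N0 N2] Np Nl Nh]||].
- have Nc : N (c + 6) = M (c + 6) by apply: Nl; lia.
  have e : B + (c + 6) - 1 = B.-1 + (c + 6) by lia.
  do 6 step.
  rewrite e; split.
  + by split; [upds | lia].
  + by split; upds.
  + move=> p pB; have [->|pc] := eqVneq p (c + 6); first by upds.
    by upds; apply: Np; lia.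
  + by move=> x xB; upds; apply: Nl.
  + by move=> x xB; upds; apply: Nh.
- split.
  + by split; [upds; lia | lia].
  + by split; upds; lia.
  + case=> [|[|[|[|[|[|p]]]]]] pB; last by lia.
    * by lia.
    * by (have -> : B.-1 + 1 = B by lia); upds.
    * by (have -> : B.-1 + 2 = B + 1 by lia); upds.
    * by (have -> : B.-1 + 3 = B + 1 + 1 by lia); upds.
    * by (have -> : B.-1 + 4 = B + 1 + 1 + 1 by lia); upds.
    * by (have -> : B.-1 + 5 = B + 1 + 1 + 1 + 1 by lia); upds.
  + by move=> x xB; upds.
  + by move=> x xB; upds.
- by lia.
Qed.

(** The array addresses are derived from [B] in cell 2 before that cell receives m. Cell 4 walks
    over n, m, K and stops at the first preference. *)
Definition setup :=
  Const 4 0 ;; Add 4 4 2 ;; Add 5 2 2 ;; Add 6 5 2 ;; Add 7 6 2 ;;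
  LoadI 1 4 ;; Add 4 4 0 ;; LoadI 2 4 ;; Add 4 4 0 ;; LoadI 3 4 ;;
  Add 4 4 0 ;; Const 8 0.

Lemma setupP (I : instance) B M :
  17 <= B -> M 0 = 1 -> M 2 = B ->
  M B = n_ I -> M (B + 1) = m_ I -> M (B + 2) = K_ I ->
  (forall (i : 'I_(n_ I)) (r : 'I_(m_ I)),
    M (B + 3 + (i * m_ I + r)) = pref_ I i r) ->
  (forall x, 2 * B <= x -> M x = 0) ->
  runs setup M 12 (fun M' => searching B (Nil 'I_(m_ I)) 0 M').
Proof.
move=> B17 M0 M2 Mn Mm MK Mp Mh.
do 5 step.
step.
step.
step.
step.
have MK' : M (B + 1 + 1) = K_ I by rewrite -MK; congr M; lia.
do 3 step.
split.
- split.
  + by split; upds.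
  + by split; upds.
  + by split; upds; lia.
  + by left; split; upds; lia.
  + by move=> i r; upds.
(* The marks need no initialisation: memory from 2B on is still zero. *)
- by move=> a; upds; apply: Mh; lia.
- by split; [upds | left].
Qed.

(* Cell [E] holds [b + E], so each register [r < E] can compute [b + r] without
   using any other register. *)
Fixpoint fetch E k :=
  if k is k'.+1 then
    fetch E k' ;; Const k' (E - k') ;; Defs.Sub k' E k' ;; LoadI k' k'
  else Const 0 0.

(** Cell 0 is left out of the frame because the base case of [fetch] overwrites it. *)
Lemma fetchP E b k M : M E = b + E -> E < b -> k <= E -> 0 < E ->
  runs (fetch E k) M (3 * k + 1) (fun M' =>
    (forall x, x < k -> M' x = M (b + x)) /\
    (forall x, k <= x -> 0 < x -> M' x = M x)).
Proof.
move=> ME Eb; elim: k => [|k IHk] kE E0.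
  by step; split=> // x _ x0; upds.
apply: (@runs_seq _ _ _ (3 * k + 1) 3); last by lia.
apply: runs_conseq (leqnn _) _; first by apply: IHk => //; lia.
move=> N [N1 N2].
have NE : N E = b + E by rewrite N2 //; lia.
have Nk : N (b + E - (E - k)) = M (b + k).
  by rewrite -N2; [congr N; lia | lia | lia].
do 3 step; split=> x.
  rewrite ltnS leq_eqVlt => /orP[/eqP->|ltx]; first by upds.
  by upds; apply: N1.
by move=> kx x0; upds; apply: N2 => //; lia.
Qed.

(** Cells above [E] are filled by an ordinary loop while the registers are still usable. Then [E]
    becomes the only register, the cells below it are fetched by straight-line code, and [E] finally
    replaces itself. Cells from n on may receive garbage. *)
Definition output E :=
  Const 15 E.+1 ;; Defs.Sub 12 1 15 ;;
  for_ 12 (Add 16 12 15 ;; Add 14 7 16 ;; LoadI 14 14 ;; StoreI 16 14) ;;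
  Const 15 E ;; Add E 7 15 ;; fetch E E ;; LoadI E E.

Lemma outputP E n b M : 17 <= E -> M 0 = 1 -> M 1 = n -> M 7 = b ->
  n <= b -> E.+1 < b ->
  runs (output E) M (6 * n + 3 * E + 8) (fun M' =>
    forall x, x < n -> M' x = M (b + x)).
Proof.
move=> E17 M0 M1 M7 nb Eb.
have -> : 6 * n + 3 * E + 8 = (6 * n + 3 * E + 6).+2 by lia.
do 2 step.
pose Inv c (N : memory) := [/\ N 12 = c /\ c <= n - E.+1,
  [/\ N 0 = 1, N 7 = b & N 15 = E.+1],
  forall x, c + E < x < n -> N x = M (b + x) &
  forall x, b <= x -> N x = M x].
apply: (@runs_seq _ _ _ (6 * n + 1) (3 * E + 4)); last by lia.
apply: (@runs_conseq _ _ (6 * n + 1) _ (Inv 0)) => //.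
  apply: (@runs_for _ _ 4 (n - E.+1) Inv)
    => [c N [[N12 _] [N0 _ _] _ _] //|c N ltc [[N12 _] [N0 N7 N15] Nx Nb]||].
  - have Nc : N (b + (c + E.+1)) = M (b + (c + E.+1)) by apply: Nb; lia.
    do 4 step; split.
    + by split; [upds | lia].
    + by split; upds.
    + move=> x xc; have [->|xE] := eqVneq x (c + E.+1); first by upds.
      by upds; apply: Nx; lia.
    + by move=> x xb; upds; apply: Nb.
  - split.
    + by split; [upds | lia].
    + by split; upds.
    + by move=> x xc; lia.
    + by move=> x xb; upds.
  - by lia.
move=> N [_ [N0 N7 N15] Nx Nb].
have -> : 3 * E + 4 = (3 * E + 1 + 1).+2 by lia.
do 2 step.
set N1 := upd _ E _.
apply: (@runs_seq _ _ _ (3 * E + 1) 1) => //.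
apply: runs_conseq (leqnn _) _.
  by apply: (@fetchP E b E N1); rewrite ?/N1; upds => //; lia.
move=> N2 [h1 h2].
have e1 : N2 E = b + E by rewrite h2 ?/N1; [upds | lia | lia].
have e2 : N2 (b + E) = M (b + E).
  by rewrite h2 /N1; [upds; rewrite Nb //; lia | lia | lia].
step=> x xn; have [->|xE] := eqVneq x E; first by upds.
upds; have [ltx|gtx] := ltnP x E.
  by rewrite h1 // /N1; upds; apply: Nb; lia.
by rewrite h2 /N1; [upds; apply: Nx; lia | lia | lia].
Qed.

(** * Layout of the encoded input *)

Lemma nth_flatten_const (T : Type) (x0 : T) (ss : seq (seq T)) m i r :
  all (fun s => size s == m) ss -> i < size ss -> r < m ->
  nth x0 (flatten ss) (i * m + r) = nth x0 (nth [::] ss i) r.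
Proof.
elim: ss i => // s ss IHss [|i] /= /andP[/eqP sm ssm] lti ltr.
  by rewrite nth_cat sm ltr.
by rewrite nth_cat sm ifN ?mulSn; [rewrite -addnA addKn IHss | lia].
Qed.

Lemma size_encode I : size (encode I) = 3 + n_ I * m_ I.
Proof.
rewrite size_cat size_flatten /shape -map_comp.
rewrite (eq_map (g := fun=> m_ I)) => [|i /=]; last first.
  by rewrite size_map size_enum_ord.
rewrite /= sumnE big_map big_const_seq count_predT size_enum_ord.
by rewrite iter_addn_0 mulnC.
Qed.

Lemma init_pref I (i : 'I_(n_ I)) (r : 'I_(m_ I)) :
  init_mem (encode I) (4 + (i * m_ I + r)) = pref_ I i r.
Proof.
rewrite /init_mem /encode /= nth_flatten_const //.
- rewrite (nth_map i) ?size_enum_ord // (nth_map r) ?size_enum_ord //.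
  by rewrite !nth_ord_enum.
- apply/allP => _ /mapP[k _ ->]; by rewrite size_map size_enum_ord.
- by rewrite size_map size_enum_ord.
Qed.

Lemma size_bitsize s : size s <= bitsize s.
Proof. by rewrite -sum1_size leq_sum. Qed.

(** * A random tuple of bounded size is nearly optimal *)

(** A discrete form of integrating t^k; the induction step keeps only the first two binomial terms
    of (m + 1)^(k + 1). *)
Lemma sum_expn_le m k : k.+1 * (\sum_(0 <= t < m) t ^ k) <= m ^ k.+1.
Proof.
elim: m => [|m IHm]; first by rewrite big_geq ?muln0.
rewrite big_nat_recr //= mulnDr.
apply: (@leq_trans (m ^ k.+1 + k.+1 * m ^ k)); first by rewrite leq_add2r.
rewrite -[m.+1]addn1 expnDn big_ord_recl big_ord_recl /= bin0 bin1.
by rewrite !exp1n !muln1 subn0 mul1n /bump /= subn1 /= addnA leq_addr.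
Qed.

Lemma card_lt_inj (T : finType) (g : T -> nat) t :
  injective g -> #|[set a | g a < t]| <= t.
Proof.
move=> inj_g; rewrite cardE -(size_map g) -[leqRHS](size_iota 0).
apply: uniq_leq_size; first by rewrite map_inj_uniq ?enum_uniq.
by move=> _ /mapP[a + ->]; rewrite mem_enum inE mem_iota.
Qed.

(* The loss [m - 1 - max_j u j] of a tuple with satisfactions [u j] is at most
   the number of thresholds [t] exceeding all of them; summing over all tuples,
   each threshold contributes at most [t ^ k]. *)
Lemma good_tuple (I : instance) k : 0 < k -> 0 < m_ I ->
  exists (F : {ffun 'I_k -> 'I_(m_ I)}) (Psi : assignment I),
    (forall i, Psi i \in codom F) /\
    k.+1 * (n_ I * (m_ I).-1) <= k.+1 * borda_sat Psi + n_ I * m_ I.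
Proof.
move=> k0 m0.
pose u (i : 'I_(n_ I)) (a : 'I_(m_ I)) := m_ I - Defs.pos i a.
have u_inj i : injective (u i).
  move=> a b; rewrite /u /Defs.pos => eq_ab.
  apply: (@perm_inj _ (pref_ I i)^-1%g); apply: val_inj => /=; move: eq_ab.
  have := ltn_ord ((pref_ I i)^-1%g a); have := ltn_ord ((pref_ I i)^-1%g b).
  by lia.
pose c (i : 'I_(n_ I)) (F : {ffun 'I_k -> 'I_(m_ I)}) :=
  \sum_(t < m_ I) if [forall j, u i (F j) < t] then 1 else 0.
have sum_c i : \sum_F c i F <= \sum_(0 <= t < m_ I) t ^ k.
  rewrite exchange_big big_mkord; apply: leq_sum => t _.
  rewrite -big_mkcond sum1dep_card.
  (* All k entries must come from the alternatives of satisfaction below [t], of which there are at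
     most [t] since [u i] is injective. *)
  apply: (@leq_trans (#|[set a | u i a < t]| ^ #|'I_k|)); last first.
    by rewrite card_ord leq_exp2r // card_lt_inj.
  rewrite -card_ffun_on; apply/subset_leq_card/subsetP => F.
  rewrite inE => /forallP lt_t; by apply/ffun_onP => j; rewrite inE.
(* Averaging: if every tuple exceeded n m, the sum over all m^k tuples would exceed n m^(k + 1),
   against [sum_c] and [sum_expn_le]. *)
have [F leF] : exists F, k.+1 * (\sum_i c i F) <= n_ I * m_ I.
  apply/existsP; rewrite -[[exists _, _]]negbK negb_exists.
  apply/negP => /forallP gt.
  have : \sum_(F : {ffun 'I_k -> 'I_(m_ I)}) (n_ I * m_ I).+1 <=
      \sum_F k.+1 * (\sum_i c i F).
    by apply: leq_sum => F _; rewrite ltnNge gt.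
  rewrite sum_nat_const card_ffun !card_ord -big_distrr exchange_big /=.
  apply/negP; rewrite -ltnNge.
  apply: (@leq_ltn_trans (n_ I * m_ I ^ k.+1)).
    apply: (@leq_trans (k.+1 * (n_ I * \sum_(0 <= t < m_ I) t ^ k))).
      apply: (@leq_trans (k.+1 * \sum_(i < n_ I) \sum_(0 <= t < m_ I) t ^ k)).
        by rewrite leq_mul2l leq_sum ?orbT.
      by rewrite sum_nat_const card_ord.
    by rewrite mulnCA leq_mul2l sum_expn_le orbT.
  by rewrite expnSr mulnCA ltn_pmul2l // expn_gt0 m0.
pose Psi : assignment I :=
  [ffun i => F [arg max_(j > Ordinal k0) u i (F j)]].
exists F, Psi; split; first by move=> i; rewrite ffunE codom_f.
apply: (@leq_trans (k.+1 * (borda_sat Psi + \sum_i c i F))); last first.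
  by rewrite mulnDr leq_add2l.
have -> : n_ I * (m_ I).-1 = \sum_(i < n_ I) (m_ I).-1.
  by rewrite sum_nat_const card_ord.
rewrite leq_mul2l /= -big_split /=.
apply: leq_sum => i _; rewrite ffunE; case: arg_maxnP => // j _ max_j.
rewrite -/(u i (F j)) /c -big_mkcond /= sum1dep_card.
have -> : [set t : 'I_(m_ I) | [forall j, u i (F j) < t]] =
    ~: [set t : 'I_(m_ I) | t < (u i (F j)).+1].
  apply/setP => t; rewrite !inE -leqNgt; apply/forallP/idP => [->//|lt_t j'].
  exact: leq_ltn_trans (max_j j' isT) lt_t.
have := cardsC [set t : 'I_(m_ I) | t < (u i (F j)).+1]; rewrite card_ord.
have := card_lt_inj (u i (F j)).+1 (@ord_inj (m_ I)).
set x := #|[set _ | _]|; set y := #|~: _|; move: x y => x y.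
by lia.
Qed.

Lemma OPT_le (I : instance) : OPT I <= n_ I * (m_ I).-1.
Proof.
apply/bigmax_leqP => Phi _.
have -> : n_ I * (m_ I).-1 = \sum_(i < n_ I) (m_ I).-1.
  by rewrite sum_nat_const card_ord.
by apply: leq_sum => i _; rewrite /Defs.pos; lia.
Qed.

(** The image of an optimal assignment is padded with a fixed alternative to exactly K entries.
    Since K and m are positive, a constant assignment is feasible, so the maximum is attained. *)
Lemma OPT_tuple (I : instance) : valid_instance I ->
  exists (T : seq 'I_(m_ I)) (Psi : assignment I),
    [/\ size T = K_ I, forall i, Psi i \in T & OPT I <= borda_sat Psi].
Proof.
move=> /andP[K0 m0]; pose a0 := Ordinal m0.
have Phi0 : feasible ([ffun=> a0] : assignment I).
  apply: (feasible_seq (T := [:: a0])) => // i.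
  by rewrite ffunE mem_head.
have [|Psi PsiF eq_OPT] := @eq_bigmax_cond _ (@feasible I) (@borda_sat I).
  by apply/card_gt0P; exists [ffun=> a0].
pose T0 := enum [set Psi i | i : 'I_(n_ I)].
exists (T0 ++ nseq (K_ I - size T0) a0), Psi; split.
- by rewrite size_cat size_nseq subnKC // -cardE.
- by move=> i; rewrite mem_cat mem_enum imset_f.
- by rewrite -eq_OPT.
Qed.

Lemma approximating_tuple beta : Rlt R0 beta -> Rlt beta R1 ->
  exists2 k, 0 < k & forall I, valid_instance I ->
    exists (T : seq 'I_(m_ I)) (Psi : assignment I),
      [/\ size T = minn k (K_ I), forall i, Psi i \in T &
        Rle (Rmult beta (INR (OPT I))) (INR (borda_sat Psi))].
Proof.
move=> beta0 beta1.
(* This choice gives 1 - 2 / (k + 1) >= beta, in the form of [k2] below. *)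
have [k kP] : exists k, Rlt (2 / (1 - beta)) (INR k) by apply: INR_unbounded.
have q0 : Rlt 0 (2 / (1 - beta)) by apply: Rdiv_lt_0_compat; lra.
have k0 : 0 < k by case: k kP => //=; lra.
have k2 : Rle 2 ((1 - beta) * INR k.+1).
  rewrite S_INR; have := Rmult_lt_compat_l (Rminus R1 beta) _ _ ltac:(lra) kP.
  have -> : Rmult (1 - beta) (2 / (1 - beta)) = IZR 2 by field; lra.
  by nra.
exists k => // I vI; have /andP[K0 m0] := vI.
have [leKk|ltkK] := leqP (K_ I) k.
  have [T [Psi [sT PsiT leO]]] := OPT_tuple vI.
  exists T, Psi; split=> //.
  have /le_INR := elimT leP leO; have := pos_INR (OPT I); nra.
have [F [Psi [PsiF le_sat]]] := good_tuple k0 m0.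
exists (codom F), Psi; split=> //.
  by rewrite size_codom card_ord.
have leO := OPT_le I.
have [m1|m2] := leqP (m_ I) 1.
  have -> : OPT I = 0 by apply/eqP; rewrite -leqn0 (leq_trans leO) //; nia.
  by rewrite Rmult_0_r; apply: pos_INR.
(* The loss is thereby measured in units of n(m - 1), the upper bound on OPT. *)
have le2 : n_ I * m_ I <= 2 * (n_ I * (m_ I).-1) by nia.
move: (n_ I * (m_ I).-1) leO le_sat le2 => X /leP/le_INR leO le_sat le2.
have {le_sat le2} /leP/le_INR : k.+1 * X <= k.+1 * borda_sat Psi + 2 * X by lia.
rewrite mult_INR plus_INR !mult_INR !S_INR /= => le_sat.
have X0 := pos_INR X; have kk := pos_INR k.
have kX := Rmult_le_compat_r _ _ _ X0 k2.
have k1 : Rlt 0 (INR k + 1) by lra.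
apply: (Rmult_le_reg_l (INR k + 1)) => //.
have : Rle (beta * INR (OPT I)) (beta * INR X).
  by apply: Rmult_le_compat_l => //; lra.
move=> /(Rmult_le_compat_l (INR k + 1) _ _ (Rlt_le _ _ k1)).
by rewrite S_INR in kX; lra.
Qed.

(** * The approximation scheme *)

Definition program h k :=
  iter h (Seq (Add 0 0 0))
    (relocate ;; setup ;; If 1 (dispatch k) (Const 8 0) ;; output (17 + k)).

Lemma leq_enum_time n m n' m' j :
  n <= n' -> m <= m' -> enum_time n m j <= enum_time n' m' j.
Proof.
move=> len lem; elim: j => [|j IHj] /=.
  by rewrite leq_add2r leq_mul // leq_add2r leq_mul2l lem.
by rewrite leq_add2r leq_mul // leq_add2r.
Qed.

Lemma leq_dispatch_time n m n' m' k :
  n <= n' -> m <= m' -> dispatch_time n m k <= dispatch_time n' m' k.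
Proof.
move=> len lem; elim: k => // k IHk.
by rewrite leq_add2r leq_add // leq_enum_time.
Qed.

Definition program_time h k n m s :=
  h + (8 * (2 ^ h * s) + 16 +
    (12 + (dispatch_time n m k + 2 + (6 * n + 3 * (17 + k) + 8)))).

(** The time bound uses [z] in place of m, because m is controlled by the input size only if there
    is an agent; otherwise the test on cell 1 bypasses the search. The bound on [h] puts [B] above
    all registers and loop counters, and above the input. *)
Lemma programP (I : instance) h k z :
  valid_instance I -> 0 < k -> 18 + k <= h -> (0 < n_ I -> m_ I <= z) ->
  runs (program h k) (init_mem (encode I))
    (program_time h k (n_ I) z (size (encode I))) (fun M' =>
    0 < n_ I -> exists Phi : assignment I, [/\ outputs M' Phi, feasible Phi &
      forall (T : seq 'I_(m_ I)) (Psi : assignment I),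
        size T = minn k (K_ I) -> (forall i, Psi i \in T) ->
        borda_sat Psi <= borda_sat Phi]).
Proof.
move=> /andP[K0 m0] k0 hk mz; set s := size _.
have sE : s = 3 + n_ I * m_ I := size_encode I.
apply: runs_doubling => M M_0 fr.
have init_out x : s < x -> init_mem (encode I) x = 0.
  by rewrite /init_mem; case: x => // x ltx; rewrite nth_default.
have {}M_0 : M 0 = 2 ^ h * s by [].
set B := 2 ^ h * s in M_0 *.
have Bk : 18 + k < B.
  apply: (@leq_trans (2 ^ h)); last by rewrite leq_pmulr // sE.
  exact: leq_ltn_trans hk (ltn_expl _ _).
have sB : s < B.
  by rewrite -[ltnLHS]mul1n ltn_mul2r sE /= -{1}(expn0 2) ltn_exp2l //; lia.
apply: runs_seq (leqnn _); apply: runs_conseq (leqnn _) _.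
  by apply: relocateP M_0; lia.
move=> M1 [M1_0 M1_2 M1p M1h].
apply: runs_seq (leqnn _); apply: runs_conseq (leqnn _) _.
  apply: (@setupP I B) => //; try lia.
  - by rewrite -(_ : B.-1 + 1 = B) ?M1p ?fr //; lia.
  - by rewrite -(_ : B.-1 + 2 = B + 1) ?M1p ?fr //; lia.
  - by rewrite -(_ : B.-1 + 3 = B + 2) ?M1p ?fr //; lia.
  - move=> i r; rewrite -init_pref.
    have im := row_le i.
    have ltr := ltn_ord r.
    have <- : B.-1 + (4 + (i * m_ I + r)) = B + 3 + (i * m_ I + r) by lia.
    by rewrite M1p ?fr //; lia.
  - by move=> x xB; rewrite M1h // fr ?init_out //; lia.
move=> M2 st.
apply: (@runs_seq _ _ _ (dispatch_time (n_ I) z k + 2)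
         (6 * n_ I + 3 * (17 + k) + 8)); last by [].
pose Post (M' : memory) := [/\ M' 0 = 1, M' 1 = n_ I, 3 * B <= M' 7 & 0 < n_ I ->
  exists v, searching B (Nil 'I_(m_ I)) v M' /\
    forall T : seq 'I_(m_ I), size T = minn k (K_ I) -> beats T v].
apply: (@runs_conseq _ _ (dispatch_time (n_ I) z k + 2) _ Post) => //.
  have [[[M2_0 M2_1] _ _ M2_67 _] _ _] := st.
  rewrite addn2; apply: runs_if; first exact: M2_1.
  - move=> n0; apply: (@runs_conseq _ _ (dispatch_time (n_ I) (m_ I) k)).
    + by apply: (@dispatchP I B k 0) => //; lia.
    + by apply/leqW/leq_dispatch_time => //; apply: mz; lia.
    + move=> N [v [stN bt]]; have [[[N_0 N_1] _ _ N_67 _] _ _] := stN.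
      by split=> //; [lia | move=> _; exists v].
  - move=> n0; step; split; first by upds.
    + by upds.
    + by upds; lia.
    + by rewrite n0.
move=> N [N_0 N_1 N_7 best_N].
have nB : n_ I <= B by rewrite (leq_trans _ (ltnW sB)) // sE; nia.
apply: runs_conseq (leqnn _) _.
  by apply: (@outputP (17 + k) (n_ I) (N 7)) => //; lia.
move=> M' M'x n0; have [v [[_ _ [_ Nb]] bt]] := best_N n0.
have gt_v (T : seq 'I_(m_ I)) (Psi : assignment I) : size T = minn k (K_ I) ->
    (forall i, Psi i \in T) -> borda_sat Psi < v.
  by move=> sT PsiT; apply: (bt T).
case: Nb => [v0|[Phi [PhiF vE PhiN]]].
  (* [v = 0] would mean that no assignment was recorded, but a constant tuple of the right length
     has been searched and forces [v] to be positive. *)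
  have : borda_sat ([ffun=> Ordinal m0] : assignment I) < v; last by rewrite v0.
  apply: (gt_v (nseq (minn k (K_ I)) (Ordinal m0))); first by rewrite size_nseq.
  by move=> i; rewrite ffunE mem_nseq eqxx andbT; lia.
exists Phi; split=> //.
  by move=> i; rewrite M'x // PhiN.
by move=> T Psi sT PsiT; rewrite -ltnS -vE; apply: (gt_v T).
Qed.

(** * Polynomial bounds on the running time; positive arguments make powers monotone in the
    exponent *)

Definition poly_bounded (f : nat -> nat) :=
  exists c d, forall z, 0 < z -> f z <= c * z ^ d.

Lemma poly_const a : poly_bounded (fun=> a).
Proof. by exists a, 0 => z _; rewrite muln1. Qed.

Lemma poly_id : poly_bounded id.
Proof. by exists 1, 1 => z _; rewrite mul1n expn1. Qed.

Lemma poly_add f g :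
  poly_bounded f -> poly_bounded g -> poly_bounded (fun z => f z + g z).
Proof.
move=> [c [d fP]] [c' [d' gP]]; exists (c + c'), (d + d') => z z0.
rewrite mulnDl leq_add //; [move: (fP z z0) | move: (gP z z0)] => /leq_trans;
  by apply; rewrite leq_mul2l leq_pexp2l ?orbT ?leq_addr ?leq_addl.
Qed.

Lemma poly_mul f g :
  poly_bounded f -> poly_bounded g -> poly_bounded (fun z => f z * g z).
Proof.
move=> [c [d fP]] [c' [d' gP]]; exists (c * c'), (d + d') => z z0.
by rewrite expnD mulnACA leq_mul ?fP ?gP.
Qed.

Lemma poly_enum_time j : poly_bounded (fun z => enum_time z z j).
Proof.
elim: j => [|j IHj] /=; do ?[assumption | exact: poly_id | exact: poly_const
  | apply: poly_add | apply: poly_mul].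
Qed.

Lemma poly_dispatch_time k : poly_bounded (fun z => dispatch_time z z k).
Proof.
elim: k => [|k IHk]; first exact: poly_const.
exact: poly_add (poly_add (poly_enum_time k.+1) IHk) (poly_const 3).
Qed.

Lemma poly_program_time h k : poly_bounded (fun z => program_time h k z z z).
Proof.
rewrite /program_time; do ?[exact: poly_dispatch_time | exact: poly_id
  | exact: poly_const | apply: poly_add | apply: poly_mul].
Qed.

Theorem theorem8 :
  forall beta : R, Rlt R0 beta -> Rlt beta R1 ->
  exists (P : cmd) (c d : nat),
    forall I : instance, valid_instance I ->
      exists (M' : memory) (t : nat),
        exec P (init_mem (encode I)) M' t /\
        t <= c * (bitsize (encode I)).+1 ^ d /\
        exists Phi : assignment I,
          outputs M' Phi /\ feasible Phi /\
          Rle (Rmult beta (INR (OPT I))) (INR (borda_sat Phi)).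
Proof.
move=> beta beta0 beta1; have [k k0 kP] := approximating_tuple beta0 beta1.
have [h hk] : exists h, 18 + k <= h by exists (18 + k).
have [c [d timeP]] := poly_program_time h k.
exists (program h k), c, d => I vI.
have [T [Psi [sT PsiT le_Psi]]] := kP I vI.
have mz : 0 < n_ I -> m_ I <= (bitsize (encode I)).+1.
  move=> n0; apply: leqW; apply: leq_trans (size_bitsize _).
  by rewrite size_encode; nia.
have [M' [t [ex [le_t post]]]] := programP vI k0 hk mz.
exists M', t; split=> //.
split.
  apply: (leq_trans le_t); apply: (leq_trans _ (timeP _ (ltn0Sn _))).
  set z := (bitsize _).+1; have sz : size (encode I) <= z.
    exact/leqW/size_bitsize.
  have nz : n_ I <= z.
    have /andP[_ m0] := vI; apply: leq_trans sz.
    by rewrite size_encode (leq_trans (leq_pmulr _ m0)) ?leq_addl.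
  have dz := leq_dispatch_time k nz (leqnn z).
  rewrite /program_time leq_add2l leq_add //.
    by rewrite leq_add2r !leq_mul2l sz !orbT.
  by lia.
have [n0|n0] := posnP (n_ I).
  (* Without agents every memory outputs every assignment, so the one supplied by the existence
     result serves. *)
  exists Psi; split; first by move=> i; have := ltn_ord i; rewrite {2}n0.
  by split=> //; apply: (feasible_seq (T := T)); rewrite // sT geq_minr.
have [Phi [outPhi feasPhi bestPhi]] := post n0.
exists Phi; split=> //; split=> //.
exact/(Rle_trans _ _ _ le_Psi)/le_INR/leP/(bestPhi T).
Qed.
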